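(* Let $\mathbf{k}$ be an algebraically closed field of characteristic $0$, let $n\ge 4$, let $V$ be an $n$-dimensional $\mathbf{k}$-vector space with basis $\{e_1,\dots,e_n\}$, and let $\Gamma=(\mathsf{V},\mathsf{E})$ be a connected simple graph with $\mathsf{V}=\{1,\dots,n\}$. If $\Gamma$ contains a triangle (i.e. a cycle on $3$ vertices), then there exists a non-monomial linear subspace $K\subseteq\bigwedge^2V$ such that $\mathcal{R}_\Gamma=\mathcal{R}(V,K)$ (equality of subsets of $V^\vee$).
   Context: For a linear subspace $K\subseteq\bigwedge^2V$, let $K^\perp=(\bigwedge^2V/K)^\vee\subseteq\bigwedge^2V^\vee$ be the space of skew-symmetric bilinear forms on $V$ vanishing on $K$. The resonance variety is $\mathcal{R}(V,K)=\{a\in V^\vee:\exists\, b\in V^\vee\text{ such that }0\ne a\wedge b\in K^\perp\}\cup\{0\}$, considered with its reduced structure. $\mathcal{R}_\Gamma=\mathcal{R}(V,K_\Gamma)$, where $K_\Gamma\subseteq\bigwedge^2V$ is the span of all $e_i\wedge e_j$ with $(i,j)\in\mathsf{E}$. A subspace $K\subseteq\bigwedge^2V$ is called monomial if there exists a basis $\{v_1,\dots,v_n\}$ of $V$ such that $K$ is generated by elements of the form $v_i\wedge v_j$; otherwise it is non-monomial. *)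

(* Defs.v *)
From HB Require Import structures.
From mathcomp Require Import all_boot all_order all_algebra.
Set Implicit Arguments.
Unset Strict Implicit.
Unset Printing Implicit Defensive.
Import GRing.Theory.
Local Open Scope ring_scope.

(* MathComp has no exterior powers, so the exterior square of a
   finite-dimensional space V is realized here as the dual of the space of
   skew-symmetric bilinear forms on V, with u /\ v being the evaluation
   B |-> B u v.  Skew-symmetric forms are alternating when 2 != 0 in k, and the
   construction is then canonically the exterior square; all definitions below
   are meant to be used under that assumption. *)
Section ExteriorSquare.
Variables (k : fieldType) (V : vectType k).

Definition dual := 'Hom(V, k^o).

Definition bilform := 'Hom(V, 'Hom(V, k^o)).

(* Meaningful only for f bilinear, see bilform_ofE. *)
Definition bilform_of (f : V -> V -> k) : bilform :=
  linfun (fun u : V => linfun (f u : V -> k^o) : 'Hom(V, k^o)).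

Lemma linfunE_lin (aT rT : vectType k) (f : aT -> rT) :
  linear f -> linfun f =1 f.
Proof.
move=> flin; pose fL := GRing.isLinear.Build k aT rT _ f flin.
pose F : {linear aT -> rT} := HB.pack f fL.
exact: (lfunE F).
Qed.

Lemma bilform_ofE (f : V -> V -> k) :
    (forall u, linear (f u : V -> k^o)) ->
    (forall v, linear (f^~ v : V -> k^o)) ->
  forall u v, bilform_of f u v = f u v.
Proof.
move=> flin2 flin1.
have inE u : linfun (f u : V -> k^o) =1 f u by apply: linfunE_lin.
move=> u v; rewrite /bilform_of linfunE_lin ?inE // => c x y.
by apply/lfunP => w; rewrite add_lfunE scale_lfunE !inE flin1.
Qed.

Definition transp (B : bilform) : bilform := bilform_of (fun u v => B v u).

Lemma transpE B u v : transp B u v = B v u.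
Proof.
apply: bilform_ofE => [w|w] c x y.
  by rewrite linearP add_lfunE scale_lfunE.
by rewrite linearP.
Qed.

(* The skew-symmetric bilinear forms, see skewformP. *)
Definition skewform : {vspace bilform} :=
  lker (linfun (fun B : bilform => B + transp B : bilform)).

Lemma skewformP (B : bilform) :
  reflect (forall u v, B u v = - B v u) (B \in skewform).
Proof.
rewrite memv_ker linfunE_lin; last first.
  move=> c B1 B2; apply/lfunP => u; apply/lfunP => v.
  by rewrite !(add_lfunE, scale_lfunE, transpE) scalerDr addrACA.
apply: (iffP eqP) => [B0 u v|Bskew].
  apply/eqP; rewrite -addr_eq0 -[B v u]transpE; apply/eqP.
  by rewrite -!add_lfunE B0 !zero_lfunE.
apply/lfunP => u; apply/lfunP => v.
by rewrite !add_lfunE !zero_lfunE transpE (Bskew u v) addNr.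
Qed.

Definition ext2 := 'Hom(subvs_of skewform, k^o).

Definition wedge (u v : V) : ext2 :=
  linfun (fun w : subvs_of skewform => (vsval w u v : k^o)).

Lemma wedgeE u v (w : subvs_of skewform) : wedge u v w = vsval w u v.
Proof.
rewrite /wedge linfunE_lin // => c x y.
by rewrite linearP !(add_lfunE, scale_lfunE).
Qed.

(* For linear forms a and b, a /\ b is the skew-symmetric form
   (u, v) |-> a(u) b(v) - a(v) b(u) on V. *)
Definition wedge_bilform (a b : dual) : bilform :=
  bilform_of (fun u v => a u * b v - a v * b u).

Lemma wedge_bilformE (a b : dual) u v :
  wedge_bilform a b u v = a u * b v - a v * b u.
Proof.
have lin (c p q r s t z : k) : p * (c * q + r) - (c * s + t) * z
    = c * (p * q - s * z) + (p * r - t * z).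
  by rewrite mulrDr mulrDl opprD addrACA mulrBr mulrCA !mulrA.
rewrite /wedge_bilform bilform_ofE // => w c x y.
  by rewrite (linearP a) (linearP b); apply: lin.
rewrite (linearP a) (linearP b) -[LHS]opprB lin opprD.
by rewrite -mulrN !opprB.
Qed.

Lemma wedge_bilform_skew (a b : dual) : wedge_bilform a b \in skewform.
Proof. by apply/skewformP => u v; rewrite !wedge_bilformE opprB. Qed.

Definition dwedge (a b : dual) : subvs_of skewform :=
  Subvs (wedge_bilform_skew a b).

Lemma dwedgeE (a b : dual) u v :
  vsval (dwedge a b) u v = a u * b v - a v * b u.
Proof. exact: wedge_bilformE. Qed.

(* A skew-symmetric form w, seen as a linear functional on ext2, sends x to
   x w; in particular it sends u /\ v to w u v by wedgeE. *)
Definition in_perp (K : {vspace ext2}) (w : subvs_of skewform) : Prop :=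
  forall x : ext2, x \in K -> x w = 0.

Definition resonance (K : {vspace ext2}) (a : dual) : Prop :=
  (exists b : dual, dwedge a b <> 0 /\ in_perp K (dwedge a b)) \/ a = 0.

Definition wedge_span (n : nat) (e : n.-tuple V) (E : rel 'I_n) :
    {vspace ext2} :=
  <<[seq wedge (tnth e p.1) (tnth e p.2)
      | p <- enum [pred p : 'I_n * 'I_n | E p.1 p.2]]>>%VS.

Definition monomial (K : {vspace ext2}) : Prop :=
  exists (v : (\dim {:V}).-tuple V) (S : rel 'I_(\dim {:V})),
    basis_of fullv v /\ K = wedge_span v S.

End ExteriorSquare.

Definition simple_graph (n : nat) (E : rel 'I_n) : Prop :=
  symmetric E /\ irreflexive E.

Definition connected_graph (n : nat) (E : rel 'I_n) : Prop :=
  forall i j : 'I_n, connect E i j.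

(* By irreflexivity, i, j, l are automatically distinct in a simple graph. *)
Definition has_triangle (n : nat) (E : rel 'I_n) : Prop :=
  exists i j l : 'I_n, [/\ E i j, E j l & E l i].

(* Main.v *)
(** Choose a triangle x, y, z of the graph and an edge z t leaving it, put
    omega = e_x^* /\ e_y^* + e_z^* /\ e_t^*, and let K be the subspace of
    K_Gamma annihilated by omega, so that K^perp = K_Gamma^perp + <omega>.
    If a /\ b lies in K^perp, then the vectors p_i = (a_i, b_i) satisfy
    [p_x, p_z] = [p_y, p_z] = 0 and [p_x, p_y] = [p_z, p_t]; either p_z = 0 or
    p_x and p_y are proportional, so [p_x, p_y] = 0 and a /\ b already lies in
    K_Gamma^perp.  Hence K and K_Gamma have the same resonance.  If K were
    monomial, K^perp would be spanned by decomposable forms, hence contained in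
    K_Gamma^perp, which does not contain omega. *)
Require Import Defs.
From HB Require Import structures.
From mathcomp Require Import all_boot all_order all_algebra.
From mathcomp Require Import ring.
Import GRing.Theory.
Local Open Scope ring_scope.

(** A fourth vertex exists and the graph is connected, so some edge leaves the triangle; a cyclic
    relabelling makes it start at [z]. *)
Lemma triangle_pendant_edge (n : nat) (E : rel 'I_n) :
    (4 <= n)%N -> simple_graph E -> connected_graph E -> has_triangle E ->
  exists x y z w : 'I_n,
    [/\ E x y, E y z, E z x, E z w & (w != x) && (w != y) && (w != z)].
Proof.
move=> n4 [symE irrE] conE [i [j [l [Eij Ejl Eli]]]].
pose T := [set i; j; l].
have Tlt : (#|T| < n)%N.
  apply: leq_trans n4; rewrite ltnS /T setUC cardsU1 cards2.
  by case: (l \notin _); case: (i != j).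
have [m mT] : exists m, m \notin T.
  apply/existsP; rewrite -negb_forall; apply: contraL Tlt => /forallP allT.
  rewrite -leqNgt -[n in (n <= _)%N]card_ord -cardsT subset_leq_card //.
  by apply/subsetP => q _; apply: allT.
have [z [w [zT wT Ezw]]] : exists z w, [/\ z \in T, w \notin T & E z w].
  have [/existsP[z /existsP[w /and3P[? ? ?]]]|noedge] :=
    boolP [exists z, exists w, [&& z \in T, w \notin T & E z w]].
    by exists z, w.
  (* With no edge leaving it, [T] would be a union of connected components and contain [m]. *)
  have clT : closed E (mem T).
    apply: intro_closed; first exact: sym_connect_sym.
    move=> z w Ezw zT; apply: contraR noedge => wT.
    by apply/existsP; exists z; apply/existsP; exists w; apply/and3P.
  have := closed_connect clT (conE i m).
  by rewrite /= (negPf mT) !inE eqxx.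
move: wT; rewrite !inE !negb_or => /andP[/andP[wi wj] wl].
move: zT; rewrite !inE => /orP[/orP[]|] /eqP zE; rewrite zE in Ezw *.
- by exists j, l, i, w; rewrite wi wj wl.
- by exists l, i, j, w; rewrite wi wj wl.
- by exists i, j, l, w; rewrite wi wj wl.
Qed.

Lemma minor_eq0 (R : idomainType) (ax bx ay by' az bz at' bt : R) :
    az * bx - ax * bz = 0 -> ay * bz - az * by' = 0 ->
    ax * by' - ay * bx - (az * bt - at' * bz) = 0 ->
  ax * by' - ay * bx = 0.
Proof.
move=> zx0 yz0 /eqP; rewrite subr_eq0 => /eqP xyzt.
(* The 2 x 2 minors of (p_x, p_y, p_z, p_t) satisfy
   [p_x, p_y] ^ 2 = [p_x, p_y] [p_z, p_t], which is 0 by the Pluecker relation. *)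
apply/eqP; rewrite -sqrf_eq0 expr2 {2}xyzt; apply/eqP.
transitivity ((by' * at' - ay * bt) * (az * bx - ax * bz)
            + (bx * at' - ax * bt) * (ay * bz - az * by')).
  by ring.
by rewrite zx0 yz0 !mulr0 addr0.
Qed.

Section ExteriorSquareLemmas.
Variables (k : fieldType) (V : vectType k).
Implicit Types (K : {vspace ext2 V}) (a b : dual V).
Implicit Types w : subvs_of (skewform V).

Definition dual_basis (m : nat) (v : m.-tuple V) (i : 'I_m) : dual V :=
  linfun (coord v i : V -> k^o).

Lemma dual_basisE (m : nat) (v : m.-tuple V) i u :
  dual_basis m v i u = coord v i u.
Proof. by rewrite /dual_basis lfunE. Qed.

Lemma dual_basis_tnth (m : nat) (v : m.-tuple V) i j :
  basis_of fullv v -> dual_basis m v i (tnth v j) = (i == j)%:R.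
Proof.
by move=> /basis_free fv; rewrite dual_basisE (tnth_nth 0) coord_free // eq_sym.
Qed.

Lemma skewform_swap w u v : vsval w u v = - vsval w v u.
Proof. exact: (skewformP _ (valP w)). Qed.

Lemma wedge_dwedgeE a b u v : wedge u v (dwedge a b) = a u * b v - a v * b u.
Proof. by rewrite wedgeE dwedgeE. Qed.

Definition annihilator w : {vspace ext2 V} :=
  lker (linfun (fun x : ext2 V => x w : k^o)).

Lemma annihilatorP (x : ext2 V) w : reflect (x w = 0) (x \in annihilator w).
Proof.
rewrite memv_ker linfunE_lin; first exact: eqP.
by move=> c x1 x2; rewrite add_lfunE scale_lfunE.
Qed.

(** As an inclusion of subspaces, orthogonality can be tested on generators. *)
Lemma in_perp_subv K w : in_perp K w <-> (K <= annihilator w)%VS.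
Proof.
split=> [Kw|/subvP Kw x /Kw/annihilatorP//].
by apply/subvP => x /Kw xw; apply/annihilatorP.
Qed.

Lemma wedge_in_span (m : nat) (v : m.-tuple V) (S : rel 'I_m) i j :
  S i j -> wedge (tnth v i) (tnth v j) \in wedge_span v S.
Proof.
by move=> Sij; apply/memv_span/mapP; exists (i, j); rewrite ?mem_enum.
Qed.

Lemma in_perp_wedge_span (m : nat) (v : m.-tuple V) (S : rel 'I_m) w :
    (forall i j, S i j -> vsval w (tnth v i) (tnth v j) = 0) ->
  in_perp (wedge_span v S) w.
Proof.
move=> Sw; apply/in_perp_subv/span_subvP => _ /mapP[[i j] + ->].
by rewrite mem_enum => Sij; apply/annihilatorP; rewrite wedgeE Sw.
Qed.

Lemma skewform_expand (m : nat) (v : m.-tuple V) w u u' :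
    basis_of fullv v ->
  vsval w u u' *+ 2 = \sum_i \sum_j vsval w (tnth v i) (tnth v j) *
    wedge u u' (dwedge (dual_basis m v i) (dual_basis m v j)).
Proof.
move=> bv.
have scaleA (c d f : k) : c *: (d *: (f : k^o)) = f * (c * d).
  by rewrite /GRing.scale/=; ring.
have expand s t : vsval w s t =
    \sum_i \sum_j vsval w (tnth v i) (tnth v j) * (coord v i s * coord v j t).
  rewrite {1}(coord_basis bv (memvf s)) linear_sum sum_lfunE.
  apply: eq_bigr => i _; rewrite linearZ scale_lfunE -tnth_nth.
  rewrite {1}(coord_basis bv (memvf t)) linear_sum scaler_sumr.
  apply: eq_bigr => j _; rewrite linearZ -tnth_nth.
  exact: scaleA.
(* Writing twice the value as [w u u' - w u' u] antisymmetrizes the products of coordinates into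
   values of [dwedge]. *)
rewrite mulr2n {2}skewform_swap !expand -sumrB.
apply: eq_bigr => i _; rewrite -sumrB; apply: eq_bigr => j _.
by rewrite wedge_dwedgeE !dual_basisE; ring.
Qed.

(** For monomial [K], the wedges of dual basis vectors over pairs not in [S] in either order span
    the orthogonal of [K]; a functional killing its decomposable elements kills all of it. *)
Lemma monomial_perp_vanish K w u u' :
    monomial K -> in_perp K w ->
    (forall a b, in_perp K (dwedge a b) -> wedge u u' (dwedge a b) = 0) ->
  vsval w u u' *+ 2 = 0.
Proof.
move=> [v [S [bv ->]]] Kw dec0; rewrite (skewform_expand _ v) //.
rewrite big1 // => i _; rewrite big1 // => j _.
have S0 p q : S p q -> vsval w (tnth v p) (tnth v q) = 0.
  by move=> Spq; rewrite -wedgeE Kw // wedge_in_span.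
have [/S0->|nSij] := boolP (S i j); first by rewrite mul0r.
have [/S0 Sji|nSji] := boolP (S j i).
  by rewrite skewform_swap Sji oppr0 mul0r.
(* The wedge of the dual vectors [i] and [j] can be nonzero on a generator [(p, q)] only if it is
   [(i, j)] or [(j, i)], and both are excluded. *)
rewrite dec0 ?mulr0 //; apply: in_perp_wedge_span => p q Spq.
rewrite dwedgeE !dual_basis_tnth //.
have [ip|_] := eqVneq i p; have [jq|_] := eqVneq j q;
  have [iq|_] := eqVneq i q; have [jp|_] := eqVneq j p; subst;
  rewrite ?Spq // in nSij nSji; by rewrite ?mulr0 ?mul0r ?subrr.
Qed.

(** [K] is the sum of its part killed by [w] and the line of [x0], and [w'] vanishes on both. *)
Lemma in_perp_cap_annihilator K w w' x0 :
    x0 \in K -> x0 w = 1 -> x0 w' = 0 ->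
  in_perp (K :&: annihilator w)%VS w' -> in_perp K w'.
Proof.
move=> Kx0 x0w x0w' perp x Kx.
suff /perp : x - x w *: x0 \in (K :&: annihilator w)%VS.
  by rewrite add_lfunE opp_lfunE scale_lfunE x0w' scaler0 subr0.
rewrite memv_cap rpredB ?rpredZ //=; apply/annihilatorP.
by rewrite add_lfunE opp_lfunE scale_lfunE x0w /GRing.scale/= mulr1 subrr.
Qed.

Section TrianglePendantEdge.
Variables (n : nat) (e : n.-tuple V) (E : rel 'I_n) (x y z t : 'I_n).
Hypotheses (be : basis_of fullv e) (irrE : irreflexive E).
Hypotheses (Exy : E x y) (Eyz : E y z) (Ezx : E z x) (Ezt : E z t).
Hypotheses (tx : t != x) (ty : t != y) (tz : t != z).

Definition two_edge_form : subvs_of (skewform V) :=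
  dwedge (dual_basis n e x) (dual_basis n e y) +
  dwedge (dual_basis n e z) (dual_basis n e t).

Definition truncated_span : {vspace ext2 V} :=
  (wedge_span e E :&: annihilator two_edge_form)%VS.

Let edge_neq i j : E i j -> (i == j) = false.
Proof. by apply: contraTF => /eqP->; rewrite irrE. Qed.

Lemma wedge_two_edge_form i j :
  wedge (tnth e i) (tnth e j) two_edge_form =
    (x == i)%:R * (y == j)%:R - (x == j)%:R * (y == i)%:R +
    ((z == i)%:R * (t == j)%:R - (z == j)%:R * (t == i)%:R).
Proof. by rewrite linearD /= !wedge_dwedgeE !dual_basis_tnth. Qed.

Let neqs :=
  (edge_neq _ _ Exy, edge_neq _ _ Eyz, edge_neq _ _ Ezx, edge_neq _ _ Ezt,
   eq_sym y x, eq_sym z y, eq_sym x z, negPf tx, negPf ty, negPf tz, eqxx).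

Let omega_simp := (neqs, mul0r, mulr0, mul1r, subr0, sub0r, addr0, add0r, oppr0).

Lemma two_edge_form_xy : wedge (tnth e x) (tnth e y) two_edge_form = 1.
Proof. by rewrite wedge_two_edge_form !omega_simp. Qed.

Lemma dwedge_perp_triangle a b :
    in_perp truncated_span (dwedge a b) ->
  wedge (tnth e x) (tnth e y) (dwedge a b) = 0.
Proof.
move=> perp.
have zx0 : wedge (tnth e z) (tnth e x) (dwedge a b) = 0.
  apply: perp; rewrite memv_cap wedge_in_span //=; apply/annihilatorP.
  by rewrite wedge_two_edge_form !omega_simp.
have yz0 : wedge (tnth e y) (tnth e z) (dwedge a b) = 0.
  apply: perp; rewrite memv_cap wedge_in_span //=; apply/annihilatorP.
  by rewrite wedge_two_edge_form !omega_simp.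
(* Here [two_edge_form] is 1 on each of the two wedges, so only their difference lies in
   [truncated_span]. *)
have : (wedge (tnth e x) (tnth e y) - wedge (tnth e z) (tnth e t)) (dwedge a b)
    = 0.
  apply: perp; rewrite memv_cap rpredB ?wedge_in_span //=; apply/annihilatorP.
  rewrite add_lfunE opp_lfunE two_edge_form_xy wedge_two_edge_form.
  by rewrite !omega_simp subrr.
rewrite add_lfunE opp_lfunE; move: zx0 yz0; rewrite !wedge_dwedgeE.
exact: minor_eq0.
Qed.

Lemma resonance_truncated_span a :
  resonance (wedge_span e E) a <-> resonance truncated_span a.
Proof.
split=> -[[b [ab0 perp]]|->]; try by right.
  left; exists b; split=> // u; rewrite memv_cap => /andP[uK _].
  exact: perp.
left; exists b; split=> //.
have Kxy := wedge_in_span _ e E _ _ Exy.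
have ab_xy := dwedge_perp_triangle _ _ perp.
exact: in_perp_cap_annihilator Kxy two_edge_form_xy ab_xy perp.
Qed.

Lemma truncated_span_not_monomial : 2 != 0 :> k -> ~ monomial truncated_span.
Proof.
move=> nz2 mono.
have perp : in_perp truncated_span two_edge_form.
  by move=> u; rewrite memv_cap => /andP[_ /annihilatorP].
(* Evaluation at the edge [x y] kills the decomposable forms but is 1 on [two_edge_form], which
   would force 2 = 0. *)
have := monomial_perp_vanish _ _ _ _ mono perp dwedge_perp_triangle.
by rewrite -wedgeE two_edge_form_xy; apply/eqP.
Qed.

End TrianglePendantEdge.
End ExteriorSquareLemmas.

Theorem mainTheorem3 (k : closedFieldType) (hk : [pchar k] =i pred0)
    (n : nat) (hn : (4 <= n)%N)
    (V : vectType k) (e : n.-tuple V) (he : basis_of fullv e)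
    (E : rel 'I_n) (hE : simple_graph E) (hconn : connected_graph E)
    (htri : has_triangle E) :
  exists K : {vspace ext2 V},
    ~ monomial K /\
    (forall a : dual V, resonance (wedge_span e E) a <-> resonance K a).
Proof.
have [x [y [z [t [Exy Eyz Ezx Ezt /andP[/andP[tx ty] tz]]]]]] :=
  triangle_pendant_edge _ _ hn hE hconn htri.
have irrE := hE.2.
exists (truncated_span k V n e E x y z t); split.
  apply: truncated_span_not_monomial => //.
  by rewrite ((pcharf0P k).1 hk).
by move=> a; apply: resonance_truncated_span.
Qed.
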